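(* Let $Y$ be a random variable satisfying the moment conditions stated in the context, let $0<q<1$, $x\in[0,1]$, $n\in\mathbb{N}_0$ and $r\in\{0,1,\dots,n\}$. Then $$[x]_q^{r}=\frac{1}{\mathrm{E}[Y^{n-r}]}\sum_{l=0}^{n}\sum_{m=0}^{n-l}\left\{{n-l\atop m}\right\}_{Y}\frac{\binom{n}{l}}{\binom{n}{r}}\bigl([x]_{q^{-1}}\bigr)_m\,B_{r,l}^{Y}(x,q).$$
   Context: Moment conditions on the random variable $Y$: there is $\rho>0$ such that $\mathrm{E}[|Y|^n]<\infty$ for all $n\ge 0$ and $\lim_{n\to\infty}|v|^n\mathrm{E}[|Y|^n]/n!=0$ for $|v|<\rho$, where $\mathrm{E}$ denotes mathematical expectation. $q$-numbers: $[x]_q=\frac{q^x-1}{q-1}$ and $[x]_{q^{-1}}=\frac{q^{-x}-1}{q^{-1}-1}$; one has $[1-x]_q=1-[x]_{q^{-1}}$. Probabilistic $q$-Bernstein polynomials $B_{r,n}^Y(x,q)$: $\sum_{n=r}^{\infty}B_{r,n}^{Y}(x,q)\frac{v^n}{n!}=\frac{(v[x]_q)^r}{r!}\left(\mathrm{E}[e^{vY}]\right)^{[1-x]_q}$, with $B_{r,l}^Y(x,q)=0$ for $l<r$. Probabilistic Stirling numbers of the second kind: $\sum_{n=m}^{\infty}\left\{{n\atop m}\right\}_Y\frac{v^n}{n!}=\frac{(\mathrm{E}[e^{vY}]-1)^m}{m!}$. $(z)_m=z(z-1)\cdots(z-m+1)$, $(z)_0=1$, is the falling factorial.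
   Formalization: The formal theorem adds the hypothesis E[Y^{n-r}] ≠ 0, without which the right-hand side is undefined (for example Y = ±1 with probability 1/2 each, n = 1, r = 0, where E[Y] = 0). *)

(* Defs.v *)
From HB Require Import structures.
From mathcomp Require Export all_boot all_order all_algebra.
From mathcomp Require Export all_classical all_reals all_analysis.

Set Implicit Arguments.
Unset Strict Implicit.
Unset Printing Implicit Defensive.

Export Order.TTheory GRing.Theory Num.Theory.
Export numFieldNormedType.Exports.

Local Open Scope classical_set_scope.
Local Open Scope ring_scope.

(* The number [x]_{q^{-1}} is [qnum q^-1 x], since (q^-1) `^ x = q `^ (- x). *)
Definition qnum (R : realType) (q x : R) : R := (q `^ x - 1) / (q - 1).

Definition falling (R : realType) (z : R) (m : nat) : R :=
  \prod_(i < m) (z - i%:R).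

Definition moment (d : measure_display) (T : measurableType d) (R : realType)
    (P : probability T R) (Y : {RV P >-> R}) (n : nat) : R :=
  fine 'E_P[fun w => (Y w ^+ n)%R].

(* Finiteness is required separately because [fine] maps +oo to 0. *)
Definition moment_conditions (d : measure_display) (T : measurableType d)
    (R : realType) (P : probability T R) (Y : {RV P >-> R}) : Prop :=
  (forall n : nat, ('E_P[fun w => (`|Y w| ^+ n)%R] < +oo)%E) /\
  exists2 rho : R, 0 < rho &
    forall v : R, `|v| < rho ->
      (fun n : nat => `|v| ^+ n * fine 'E_P[fun w => (`|Y w| ^+ n)%R] / n`!%:R)
        @ \oo --> (0 : R).

Definition mgf (d : measure_display) (T : measurableType d) (R : realType)
    (P : probability T R) (Y : {RV P >-> R}) (v : R) : R := fine ('M_P Y v).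

(* c is the sequence with sum_{n >= k} c_n v^n / n! = F v, where a generating
   function identity is understood as convergence for all v in some
   neighbourhood of 0, and c vanishes below the first index k of the sum. *)
Definition is_egf (R : realType) (k : nat) (F : R -> R) (c : nat -> R) : Prop :=
  (forall l : nat, (l < k)%N -> c l = 0) /\
  exists2 delta : R, 0 < delta &
    forall v : R, `|v| < delta ->
      (fun N : nat => \sum_(k <= n < N) c n * (v ^+ n / n`!%:R))
        @ \oo --> F v.

(* The coefficients are unique when they exist; the zero sequence is a default
   value for an F that has no such expansion. *)
Definition egf_coef (R : realType) (k : nat) (F : R -> R) : nat -> R :=
  xget (fun=> 0) [set c | is_egf k F c].

Definition qBernstein (d : measure_display) (T : measurableType d)
    (R : realType) (P : probability T R) (Y : {RV P >-> R})
    (r n : nat) (x q : R) : R :=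
  egf_coef r (fun v => (v * qnum q x) ^+ r / r`!%:R
                       * mgf Y v `^ qnum q (1 - x)) n.

Definition pstirling2 (d : measure_display) (T : measurableType d)
    (R : realType) (P : probability T R) (Y : {RV P >-> R})
    (n m : nat) : R :=
  egf_coef m (fun v => (mgf Y v - 1) ^+ m / m`!%:R) n.

(* Main.v *)
Require Import Defs.
From mathcomp Require Import all_boot all_order all_algebra.
From mathcomp Require Import all_classical all_reals all_analysis.
From mathcomp Require Import measurable_realfun ring lra.

Set Implicit Arguments.
Unset Strict Implicit.
Unset Printing Implicit Defensive.

(* Let F be the moment generating function of Y, a = [1 - x]_q and
   z = [x]_{q^-1}, so that a + z = 1 and F^z * (b v^r F^a) = b v^r F with
   b = [x]_q^r / r!.  The identity compares the coefficients of v^n on both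
   sides: B_{r,l} / l! is the l-th coefficient of b v^r F^a, and
   sum_m (z)_m S(k,m) / k! is the k-th coefficient of
   F^z = sum_m (z)_m (F - 1)^m / m!.  That the formal binomial series of F^a
   converges to F^a follows from the differential equation F G' = a F' G: it
   gives a recurrence, hence a geometric bound, for the coefficients, and then
   shows that G F^{-a} is constant near 0. *)

Local Open Scope ring_scope.

(** * Formal power series: products, powers and the binomial series *)

Section FormalPowerSeries.
Context {R : realType}.
Implicit Types (a : R) (c d f u : nat -> R) (p q : {poly R}).

Definition cauchy_prod c d : nat -> R :=
  fun n => \sum_(i < n.+1) c i * d (n - i)%N.

(* The coefficient of X^n in (sum_i u_i X^i)^m only depends on u_0, ..., u_n. *)
Definition cpow u m : nat -> R :=
  fun n => ((\poly_(i < n.+1) u i) ^+ m)`_n.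

Lemma coef_exp_trunc p q m n :
  (forall i, (i <= n)%N -> p`_i = q`_i) ->
  forall i, (i <= n)%N -> (p ^+ m)`_i = (q ^+ m)`_i.
Proof.
move=> pq; elim: m => [|m IH] i ile; first by rewrite !expr0.
rewrite !exprS !coefM; apply: eq_bigr => j _; congr (_ * _).
  by apply: pq; apply: leq_trans ile; rewrite -ltnS.
by apply: IH; apply: leq_trans ile; exact: leq_subr.
Qed.

Lemma coef_poly_exp u m n N : (n < N)%N ->
  ((\poly_(i < N) u i) ^+ m)`_n = cpow u m n.
Proof.
move=> nN; apply: (@coef_exp_trunc _ _ _ n) => // i ile.
by rewrite !coef_poly ltnS ile (leq_ltn_trans ile nN).
Qed.

Lemma cpowS u m : cpow u m.+1 = cauchy_prod u (cpow u m).
Proof.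
apply/funext => n; rewrite /cpow /cauchy_prod exprS coefM; apply: eq_bigr => i _.
rewrite coef_poly ltn_ord; congr (_ * _).
by rewrite coef_poly_exp// ltnS leq_subr.
Qed.

(** As [u] has no constant term, X^m divides the m-th power. *)
Lemma cpow_small u m n : u 0%N = 0 -> (n < m)%N -> cpow u m n = 0.
Proof.
move=> u0 nm; rewrite /cpow.
have -> : \poly_(i < n.+1) u i = 'X * \poly_(i < n) u i.+1.
  by apply/polyP => -[|i]; rewrite coefXM !coef_poly.
by rewrite exprMn coefXnM nm.
Qed.

Lemma fallingS a m : falling a m.+1 = falling a m * (a - m%:R).
Proof. by rewrite /falling big_ord_recr. Qed.

(* The coefficients of (1 + sum_i u_i X^i)^a; when u_0 = 0, only the terms
   m <= n of the binomial series contribute to X^n. *)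
Definition fpow_coef a u : nat -> R :=
  fun n => \sum_(m < n.+1) falling a m / m`!%:R * cpow u m n.

(** A single polynomial carries all coefficients of index below [N], so that [binomial_poly_ode] can
    be applied to them. *)
Lemma fpow_coefE a u n N : u 0%N = 0 -> (n < N)%N ->
  fpow_coef a u n =
  (\sum_(m < N) (falling a m / m`!%:R) *: (\poly_(i < N) u i) ^+ m)`_n.
Proof.
move=> u0 nN; rewrite coef_sum /fpow_coef.
under [RHS]eq_bigr do rewrite coefZ coef_poly_exp//.
rewrite (big_ord_widen N (fun m => falling a m / m`!%:R * cpow u m n))//.
rewrite big_mkcond /=; apply: eq_bigr => m _.
by case: ltnP => // nm; rewrite cpow_small// mulr0.
Qed.

Lemma fpow_coef0 a u : fpow_coef a u 0 = 1.
Proof.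
by rewrite /fpow_coef big_ord1 /falling big_ord0 divr1 mul1r /cpow expr0 coef1.
Qed.

(* The truncated binomial series solves the differential equation of (1 + p)^a
   up to its last term. *)
Lemma binomial_poly_ode a p N :
  let G := \sum_(m < N.+1) (falling a m / m`!%:R) *: p ^+ m in
  (1 + p) * G^`() - a *: (p^`() * G) =
  - (falling a N.+1 / N`!%:R) *: (p ^+ N * p^`()).
Proof.
elim: N => [|N IH] /=.
  rewrite big_ord1 fallingS /falling big_ord0 divr1 mul1r subr0 divr1 expr0.
  rewrite scale1r derivC mulr0 mulr1 mul1r add0r scaleNr//.
rewrite big_ord_recr /=; set G := \sum_(_ < _) _ in IH *.
set b := falling a N.+1 / _.
rewrite derivD mulrDr mulrDr scalerDr opprD addrACA IH.
rewrite derivZ deriv_exp /= (fallingS _ N.+1).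
have bE : falling a N.+1 / N`!%:R = N.+1%:R * b.
  by rewrite /b factS natrM invfM mulrCA mulVKf ?pnatr_eq0.
rewrite bE -/b (mulrAC _ (a - _)) -/b.
rewrite -!mul_polyC !rmorphN !rmorphM rmorphB /= !rmorph_nat -mulr_natl exprS.
by ring.
Qed.

(** Truncating at degree n + 1 makes the error term of [binomial_poly_ode] a multiple of p^(n+1),
    which has no coefficient of index n; what remains is (1 + U) G' = a U' G at X^n. *)
Lemma fpow_coef_rec a u n : u 0%N = 0 ->
  cauchy_prod (fun k => (k == 0)%:R + u k) (pseries_diffs (fpow_coef a u)) n =
  a * cauchy_prod (pseries_diffs u) (fpow_coef a u) n.
Proof.
move=> u0; pose p := \poly_(i < n.+2) u i.
pose G := \sum_(m < n.+2) (falling a m / m`!%:R) *: p ^+ m.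
have GE k : (k < n.+2)%N -> fpow_coef a u k = G`_k.
  by move=> kn; exact: fpow_coefE.
have -> : cauchy_prod (fun k => (k == 0)%:R + u k)
     (pseries_diffs (fpow_coef a u)) n = ((1 + p) * G^`())`_n.
  rewrite coefM; apply: eq_bigr => i _.
  rewrite coefD coef1 coef_poly ltnS ltnW// coef_deriv /pseries_diffs.
  by rewrite GE ?mulr_natl// !ltnS leq_subr.
have -> : cauchy_prod (pseries_diffs u) (fpow_coef a u) n = (p^`() * G)`_n.
  rewrite coefM; apply: eq_bigr => i _.
  rewrite coef_deriv coef_poly !ltnS -ltnS ltn_ord -mulr_natl GE//.
  by rewrite ltnS leqW// leq_subr.
apply/eqP; rewrite -subr_eq0 -coefZ -coefB binomial_poly_ode coefZ.
rewrite coefM big1 ?mulr0// => i _.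
rewrite coef_poly_exp ?cpow_small ?mul0r ?(leq_trans (ltn_ord i))//.
Qed.

(** Equivalent to a positive radius of convergence, but stated on the coefficients alone. *)
Definition geo_bounded c :=
  exists2 C : R, 0 <= C & exists2 M : R, 0 < M &
    forall n, `|c n| <= C * M ^+ n.

(** Since 1 + U has constant term 1, the recurrence expresses (n + 1) g_(n+1) through g_0, ..., g_n,
    and strong induction applies. *)
Lemma geo_bounded_fpow_coef a u : u 0%N = 0 ->
  geo_bounded u -> geo_bounded (fpow_coef a u).
Proof.
move=> u0 [C C0 [M M0 uM]].
(* Chosen so that |a (i + 1) - (n - i)| <= A (n + 1) for i <= n. *)
pose A : R := `|a| + 1; have A0 : 0 < A by rewrite ltr_wpDl.
(* With this L, A C sum_(i <= n) M^(i+1) L^(n-i) = L^(n+1) - M^(n+1). *)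
pose L := M + M * (A * C).
have LM : M <= L by rewrite lerDl !mulr_ge0 ?(ltW M0) ?(ltW A0).
have L0 : 0 < L by exact: lt_le_trans LM.
exists 1 => //; exists L => // n; rewrite mul1r.
elim/ltn_ind: n => -[|n] IH; first by rewrite fpow_coef0 normr1 expr0.
have := fpow_coef_rec a n u0; rewrite /cauchy_prod.
rewrite big_ord_recl /= u0 addr0 mul1r subn0 {1}/pseries_diffs.
move/eqP; rewrite eq_sym -subr_eq mulr_sumr => /eqP.
(* The added term i = n has the factor n - i = 0; it gives both sums of the recurrence the same
   range. *)
have -> : \sum_(i < n) ((bump 0 i == 0)%:R + u (bump 0 i)) *
     pseries_diffs (fpow_coef a u) (n - bump 0 i) =
   \sum_(i < n.+1) u i.+1 * (n - i)%:R * fpow_coef a u (n - i).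
  rewrite big_ord_recr /= subnn mulr0 mul0r addr0; apply: eq_bigr => i _.
  rewrite add0r /pseries_diffs /bump leq0n add1n /=.
  by rewrite mulrA subnS prednK// subn_gt0.
rewrite -sumrB => rec.
have : `|n.+1%:R * fpow_coef a u n.+1| <= n.+1%:R * L ^+ n.+1.
  rewrite -rec (le_trans (ler_norm_sum _ _ _))//.
  apply: (@le_trans _ _ (\sum_(i < n.+1)
            n.+1%:R * (A * C * M) * (L ^+ (n - i) * M ^+ i))).
    apply: ler_sum => i _.
    rewrite /pseries_diffs.
    have -> : a * (i.+1%:R * u i.+1 * fpow_coef a u (n - i)) -
      u i.+1 * (n - i)%:R * fpow_coef a u (n - i) =
      (a * i.+1%:R - (n - i)%:R) * u i.+1 * fpow_coef a u (n - i) by ring.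
    rewrite !normrM.
    have h1 : `|a * i.+1%:R - (n - i)%:R| <= A * n.+1%:R.
      rewrite (le_trans (ler_normB _ _))// mulrDl normrM mul1r.
      rewrite !normr_nat lerD ?ler_wpM2l// ?ler_nat//.
      by rewrite leqW// leq_subr.
    have -> : n.+1%:R * (A * C * M) * (L ^+ (n - i) * M ^+ i) =
      (A * n.+1%:R) * (C * M ^+ i.+1) * L ^+ (n - i) by rewrite exprS; ring.
    by rewrite ler_pM ?mulr_ge0 ?normr_ge0// ?ler_pM// IH// ltnS leq_subr.
  rewrite -mulr_sumr -mulrA ler_wpM2l//.
  have := subrXX L M n.+1.
  rewrite /= (_ : L - M = A * C * M); last by rewrite /L; ring.
  by move=> <-; rewrite gerBl exprn_ge0// ltW.
by rewrite normrM normr_nat ler_pM2l.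
Qed.

End FormalPowerSeries.

(** * Functions with a power series expansion near 0 *)

Section PowerSeries.
Context {R : realType}.
Local Open Scope classical_set_scope.
Implicit Types (a : R) (c d u : nat -> R) (F G : R -> R).

(** No radius is recorded, so expansions combine by filter reasoning. *)
Definition has_ps c F := \forall v \near (0 : R), pseries c v @ \oo --> F v.

Lemma nbhs0_norm_lt (e : R) : 0 < e -> \forall v \near (0 : R), `|v| < e.
Proof.
move=> e0; apply/nbhs_ballP; exists e => // v.
by rewrite /ball/= sub0r normrN.
Qed.

Lemma near0P (A : set R) : (\forall v \near (0 : R), A v) <->
  exists2 e : R, 0 < e & forall v, `|v| < e -> A v.
Proof.
split=> [/nbhs_ballP[e e0 eA]|[e e0 eA]].
  by exists e => // v ve; apply: eA; rewrite /ball/= sub0r normrN.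
by apply: filterS (nbhs0_norm_lt e0) => v; exact: eA.
Qed.

Lemma has_psP c F : has_ps c F <-> exists2 e : R, 0 < e &
  forall v, `|v| < e -> pseries c v @ \oo --> F v.
Proof. exact: near0P. Qed.

Lemma near_has_ps c F G :
  (\forall v \near (0 : R), F v = G v) -> has_ps c F -> has_ps c G.
Proof. by apply: filterS2 => v ->. Qed.

Lemma has_ps0 c F : has_ps c F -> F 0 = c 0%N.
Proof.
move=> /nbhs_singleton cF.
suff c0 : pseries c 0 @ \oo --> c 0%N by exact: cvg_unique cF c0.
(* The shift skips the empty partial sum, which is 0 and not [c 0]. *)
rewrite -(cvg_shiftS (pseries c 0)) /=.
rewrite [X in X @ _ --> _](_ : _ = cst (c 0%N)); first exact: cvg_cst.
apply/funext => n; rewrite /pseries /series /= big_nat_recl// expr0 mulr1.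
by rewrite big1 ?addr0// => i _; rewrite exprS mul0r mulr0.
Qed.

(** The terms of a convergent series are bounded; at the point e / 2 this gives the ratio (e /
    2)^-1. *)
Lemma has_ps_geo c F : has_ps c F -> geo_bounded c.
Proof.
move=> /has_psP[e e0 cF].
have e20 : 0 < e / 2 by rewrite divr_gt0.
have /cF cv : `|e / 2| < e by rewrite gtr0_norm// ltr_pdivrMr// ltr_pMr// ltr1n.
have /cvg_series_bounded[K [Kr Kf]] : cvgn (pseries c (e / 2)).
  by apply/cvg_ex; exists (F (e / 2)).
have K1 n : `|c n * (e / 2) ^+ n| <= `|K| + 1.
  by apply: Kf => //; rewrite (le_lt_trans (ler_norm _))// ltrDl.
exists (`|K| + 1); first by rewrite addr_ge0.
exists (e / 2)^-1; first by rewrite invr_gt0.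
move=> n; rewrite exprVn ler_pdivlMr ?exprn_gt0//.
by rewrite (le_trans _ (K1 n))// normrM [X in _ <= _ * X]ger0_norm ?exprn_ge0// ltW.
Qed.

Lemma geo_bounded_normed_cvg c C M v : (forall n, `|c n| <= C * M ^+ n) ->
  0 <= C -> 0 < M -> M * `|v| < 1 -> cvgn [normed pseries c v].
Proof.
move=> cM C0 M0 Mv.
have Mv0 : 0 <= M * `|v| by rewrite mulr_ge0// ltW.
apply: (@series_le_cvg _ _ (geometric C (M * `|v|))) => //=.
- by move=> n; rewrite mulr_ge0// exprn_ge0.
- move=> n; rewrite normrM normrX exprMn mulrA ler_wpM2r// exprn_ge0//.
- by apply: is_cvg_geometric_series; rewrite ger0_norm.
Qed.

Lemma geo_bounded_has_ps c : geo_bounded c ->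
  has_ps c (fun v => limn (pseries c v)).
Proof.
move=> [C C0 [M M0 cM]]; apply/has_psP; exists M^-1; first by rewrite invr_gt0.
move=> v vM; apply: normed_cvg; apply: (geo_bounded_normed_cvg cM C0 M0).
by rewrite mulrC -ltr_pdivlMr// div1r.
Qed.

(** The factor n + 1 is at most 2^n, which doubles the ratio. *)
Lemma geo_bounded_diffs c : geo_bounded c -> geo_bounded (pseries_diffs c).
Proof.
move=> [C C0 [M M0 cM]]; exists (C * M); first by rewrite mulr_ge0// ltW.
exists (2 * M); first by rewrite mulr_gt0.
move=> n; rewrite /pseries_diffs normrM normr_nat exprMn.
have -> : C * M * (2 ^+ n * M ^+ n) = 2 ^+ n * (C * M ^+ n.+1).
  by rewrite exprS; ring.
apply: ler_pM => //.
by rewrite -natrX ler_nat ltn_expl.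
Qed.

(** Termwise differentiation asks for convergence at one point, here e / 2, of the series and its
    first two derived series; geometric bounds provide all three. *)
Lemma has_ps_derive c F : has_ps c F ->
  exists2 F', has_ps (pseries_diffs c) F' &
    \forall v \near (0 : R), is_derive v (1 : R) F (F' v).
Proof.
move=> cF; have gc := has_ps_geo cF.
have gd := geo_bounded_diffs gc; have gdd := geo_bounded_diffs gd.
exists (fun v => limn (pseries (pseries_diffs c) v)).
  exact: geo_bounded_has_ps.
have /has_psP[e1 e10 h1] := geo_bounded_has_ps gc.
have /has_psP[e2 e20 h2] := geo_bounded_has_ps gd.
have /has_psP[e3 e30 h3] := geo_bounded_has_ps gdd.
pose e := Num.min e1 (Num.min e2 e3).
have e0 : 0 < e by rewrite !lt_min e10 e20.
have ke : `|e / 2| < e.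
  by rewrite gtr0_norm ?divr_gt0// ltr_pdivrMr// ltr_pMr// ltr1n.
move: (ke); rewrite !lt_min => /and3P[k1 k2 k3].
have /nbhs0_norm_lt : 0 < `|e / 2| by rewrite gtr0_norm divr_gt0.
(* The derivative at v depends on [F] around v, so the expansion is needed for all w near v. *)
move: cF => /near_join; apply: filterS2 => v cF vk.
have D := pseries_snd_diffs (h1 _ k1) (h2 _ k2) (h3 _ k3) vk.
apply: near_eq_is_derive D.
by apply: filterS cF => w /cvg_lim ->.
Qed.

Lemma has_psB c d F G : has_ps c F -> has_ps d G ->
  has_ps (fun n => c n - d n) (fun v => F v - G v).
Proof.
apply: filterS2 => v cF dG.
rewrite [X in X @ _ --> _](_ : _ = pseries c v \- pseries d v); first exact: cvgB.
apply/funext => n; rewrite /pseries /series /= -sumrB.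
by apply: eq_bigr => i _; rewrite mulrBl.
Qed.

(* Successive derivatives of the zero function vanish at 0. *)
Lemma has_ps_eq0 c : has_ps c (fun=> 0) -> forall n, c n = 0.
Proof.
move=> c0 n; elim: n c c0 => [|n IH] c c0; first by rewrite -(has_ps0 c0).
have [F' cF' dF'] := has_ps_derive c0.
have /IH : has_ps (pseries_diffs c) (fun=> 0).
  apply: near_has_ps cF'; apply: filterS dF' => v dv.
  by rewrite -(@derive_val _ _ _ _ _ _ _ dv) derive_cst.
by move/eqP; rewrite /pseries_diffs mulf_eq0 pnatr_eq0 => /eqP.
Qed.

Lemma has_ps_unique c d F : has_ps c F -> has_ps d F -> c = d.
Proof.
move=> cF dF; apply/funext => n; apply/eqP; rewrite -subr_eq0; apply/eqP.
apply: (@has_ps_eq0 (fun n => c n - d n)).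
by apply: near_has_ps (has_psB cF dF); near=> v; rewrite subrr.
Unshelve. all: by end_near. Qed.

Lemma sum_cauchy_prod c d N : \sum_(0 <= n < N) cauchy_prod c d n =
  \sum_(0 <= i < N) \sum_(0 <= j < N - i) c i * d j.
Proof.
elim: N => [|N IH]; first by rewrite !big_geq.
rewrite big_nat_recr//= IH [RHS]big_nat_recr//= subSnn big_nat1.
rewrite /cauchy_prod big_ord_recr /= subnn addrA; congr (_ + _).
rewrite -(big_mkord xpredT (fun i => c i * d (N - i)%N)) -big_split /=.
apply: eq_big_nat => i /andP[_ iN].
by rewrite subSn ?(ltnW iN)// big_nat_recr.
Qed.

(** The square i, j < N without the triangle i + j < N. *)
Lemma cauchy_prod_remainder c d N :
  (\sum_(0 <= n < N) c n) * (\sum_(0 <= n < N) d n) -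
  \sum_(0 <= n < N) cauchy_prod c d n =
  \sum_(0 <= i < N) \sum_(N - i <= j < N) c i * d j.
Proof.
rewrite sum_cauchy_prod mulr_suml -sumrB; apply: eq_bigr => i _.
rewrite (@big_cat_nat _ _ _ (N - i)) ?leq_subr//= mulrDr !mulr_sumr.
by rewrite addrC addKr.
Qed.

Lemma cauchy_prod_scale c d (v : R) n :
  cauchy_prod c d n * v ^+ n =
  cauchy_prod (fun n => c n * v ^+ n) (fun n => d n * v ^+ n) n.
Proof.
rewrite /cauchy_prod mulr_suml; apply: eq_bigr => i _.
have -> : v ^+ n = v ^+ i * v ^+ (n - i) by rewrite -exprD subnKC// -ltnS.
by ring.
Qed.

(** The ratio is 1/8 = (1/2)^3 for the sake of [has_psM]: two factors 2^-N absorb N^2 and the third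
    tends to 0. *)
Lemma geo_bounded_near c : geo_bounded c -> exists2 C : R, 0 <= C &
  \forall v \near (0 : R), forall n, `|c n * v ^+ n| <= C * 8^-1 ^+ n.
Proof.
move=> [C C0 [M M0 cM]]; exists C => //.
have /nbhs0_norm_lt : 0 < (8 * M)^-1 by rewrite invr_gt0 mulr_gt0.
apply: filterS => v vM n.
have Mv : M * `|v| <= 8^-1.
  by rewrite -ler_pdivlMl// -invfM mulrC ltW.
rewrite normrM normrX (@le_trans _ _ (C * (M * `|v|) ^+ n))//.
  by rewrite exprMn mulrA ler_wpM2r// exprn_ge0.
by rewrite ler_wpM2l// lerXn2r ?nnegrE ?invr_ge0 ?mulr_ge0 ?(ltW M0).
Qed.

(* The i, j < N terms missing from the Cauchy product have i + j >= N; near 0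
   there are at most N^2 of them, each at most C D 8^-N, while N <= 2^N. *)
Lemma has_psM c d F G : has_ps c F -> has_ps d G ->
  has_ps (cauchy_prod c d) (fun v => F v * G v).
Proof.
move=> cF dG.
have [C C0 cC] := geo_bounded_near (has_ps_geo cF).
have [D D0 dD] := geo_bounded_near (has_ps_geo dG).
near=> v.
have cv : pseries c v @ \oo --> F v by near: v.
have dv : pseries d v @ \oo --> G v by near: v.
have cCv : forall n, `|c n * v ^+ n| <= C * 8^-1 ^+ n by near: v.
have dDv : forall n, `|d n * v ^+ n| <= D * 8^-1 ^+ n by near: v.
apply: cvg_sub0 (cvgM cv dv).
apply: norm_cvg0.
apply: (@squeeze_cvgr _ _ _ _ (cst 0) (geometric (C * D) (2^-1 : R))).
- apply: nearW => N; rewrite normr_ge0 /=.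
  rewrite distrC.
  have -> : pseries (cauchy_prod c d) v N = \sum_(0 <= n < N)
     cauchy_prod (fun n => c n * v ^+ n) (fun n => d n * v ^+ n) n.
    rewrite /pseries /series /=; apply: eq_bigr => i _.
    by rewrite cauchy_prod_scale.
  rewrite cauchy_prod_remainder (le_trans (ler_norm_sum _ _ _))//.
  apply: (@le_trans _ _ (\sum_(0 <= i < N) N%:R * (C * D * 8^-1 ^+ N))).
    apply: ler_sum_nat => i /andP[_ iN].
    rewrite (le_trans (ler_norm_sum _ _ _))//.
    apply: (@le_trans _ _ (\sum_(N - i <= j < N) C * D * 8^-1 ^+ N)).
      apply: ler_sum_nat => j /andP[Nij jN].
      rewrite normrM (le_trans (ler_pM _ _ (cCv i) (dDv j)))//.
      rewrite mulrACA -exprD ler_wpM2l ?mulr_ge0//.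
      by rewrite ler_wiXn2l// ?invf_le1 ?ler1n// -leq_subLR.
    rewrite sumr_const_nat -[leLHS]mulr_natl ler_wpM2r ?mulr_ge0 ?exprn_ge0//.
    by rewrite ler_nat leq_subr.
  rewrite sumr_const_nat subn0 -[leLHS]mulr_natl.
  have -> : (8 : R)^-1 ^+ N = 2^-1 ^+ N * 2^-1 ^+ N * 2^-1 ^+ N.
    by rewrite -!exprMn; congr (_ ^+ _); lra.
  have N2 : N%:R * 2^-1 ^+ N <= 1 :> R.
    rewrite exprVn ler_pdivrMr ?exprn_gt0// mul1r -natrX ler_nat ltnW//.
    exact: ltn_expl.
  have -> : N%:R * (N%:R * (C * D * (2^-1 ^+ N * 2^-1 ^+ N * 2^-1 ^+ N))) =
    C * D * 2^-1 ^+ N * ((N%:R * 2^-1 ^+ N) * (N%:R * 2^-1 ^+ N)) :> R by ring.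
  rewrite ler_piMr ?mulr_ge0 ?exprn_ge0//.
  by rewrite mulr_ile1 ?mulr_ge0 ?exprn_ge0.
- exact: cvg_cst.
- by apply: cvg_geometric; rewrite ger0_norm//; lra.
Unshelve. all: by end_near. Qed.

Lemma has_psZ a c F : has_ps c F -> has_ps (fun n => a * c n) (fun v => a * F v).
Proof.
move=> cF; apply: filterS cF => v cF.
rewrite [X in X @ _ --> _](_ : _ = a \*o pseries c v); first exact: cvgMr.
apply/funext => n; rewrite /pseries /series /= mulr_sumr.
by apply: eq_bigr => i _; rewrite mulrA.
Qed.

Lemma has_ps_poly (p : {poly R}) : has_ps (fun n => p`_n) (fun v => p.[v]).
Proof.
near=> v; apply: cvg_near_cst.
exists (size p) => // N /= pN.
rewrite /pseries /series /= horner_coef big_mkord.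
rewrite (big_ord_widen N (fun i => p`_i * v ^+ i) pN) [RHS]big_mkcond /=.
by apply: eq_bigr => i _; case: ltnP => // ?; rewrite nth_default ?mul0r.
Unshelve. all: by end_near. Qed.

Lemma has_psB1 u F : has_ps (fun k => (k == 0)%:R + u k) F ->
  has_ps u (fun v => F v - 1).
Proof.
move=> fF; apply: filterS (has_psB fF (has_ps_poly (1 : {poly R}))) => v.
rewrite hornerC (_ : (fun n => _) = u)//; apply/funext => n.
by rewrite coef1 addrC addKr.
Qed.

Lemma has_ps_cpow u F m : has_ps u F -> has_ps (cpow u m) (fun v => F v ^+ m).
Proof.
move=> uF; elim: m => [|m IH].
  have := has_ps_poly (1 : {poly R}).
  rewrite (_ : (fun n => _) = cpow u 0).
    by apply: near_has_ps; near=> v; rewrite hornerC expr0.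
  by apply/funext => n; rewrite /cpow expr0.
by rewrite cpowS; under eq_fun do rewrite exprS; exact: has_psM.
Unshelve. all: by end_near. Qed.

(** Mean value theorem on segments inside the ball; [key] is stated for ordered endpoints and serves
    both signs of v. *)
Lemma near_is_derive0_cst (H : R -> R) :
  (\forall v \near (0 : R), is_derive v (1 : R) H 0) ->
  \forall v \near (0 : R), H v = H 0.
Proof.
move=> /near0P[e e0 dH]; apply/near0P; exists e => // v ve.
have key x y : x <= y -> `|x| < e -> `|y| < e -> H x = H y.
  move=> xy xe ye.
  have inI z : z \in `[x, y]%R -> `|z| < e.
    rewrite in_itv/= => /andP[xz zy].
    move: xe ye; rewrite !ltr_norml => /andP[? ?] /andP[? ?].
    by rewrite (lt_le_trans _ xz)//= (le_lt_trans zy).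
  have [] := @MVT_segment R H (fun=> 0) x y xy.
  - move=> z; rewrite in_itv/= => /andP[xz zy]; apply: dH; apply: inI.
    by rewrite in_itv/= !ltW.
  - apply: derivable_within_continuous => z zI.
    by have [] := dH _ (inI _ zI).
  - by move=> z _ /eqP; rewrite mul0r subr_eq0 => /eqP.
have n0 : `|0 : R| < e by rewrite normr0.
by have [v0|/ltW v0] := lerP v 0; [exact: key|exact/esym/key].
Qed.

(** [F] is differentiable, hence continuous, at 0, where its value is [c 0]. *)
Lemma has_ps_near_gt0 c F : has_ps c F -> 0 < c 0%N ->
  \forall v \near (0 : R), 0 < F v.
Proof.
move=> cF c0; have [F' _ dF] := has_ps_derive cF.
suff Fc : F v @[v --> 0] --> F 0 by apply: (cvgr_gt _ Fc); rewrite (has_ps0 cF).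
apply: differentiable_continuous; apply/derivable1_diffP.
by have [] := nbhs_singleton dF.
Qed.

(** The sum G of the binomial series and F^a solve the same first-order linear equation and are both
    1 at 0. *)
Lemma has_ps_powR a u F : u 0%N = 0 ->
  has_ps (fun k => (k == 0)%:R + u k) F ->
  has_ps (fpow_coef a u) (fun v => F v `^ a).
Proof.
move=> u0 fF.
have gu : geo_bounded (fpow_coef a u).
  exact/geo_bounded_fpow_coef/(has_ps_geo (has_psB1 fF)).
have gG := geo_bounded_has_ps gu; set G := fun v => _ in gG.
have [F' fF' dF] := has_ps_derive fF.
have [G' gG' dG] := has_ps_derive gG.
(* Both sides have the same coefficients by [fpow_coef_rec], hence the same sum near 0. *)
have ode : \forall v \near (0 : R), F v * G' v = a * (F' v * G v).
  have h1 := has_psM fF gG'.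
  have h2 := has_psZ a (has_psM fF' gG).
  rewrite (_ : cauchy_prod _ _ = (fun n => a * cauchy_prod
     (pseries_diffs (fun k => (k == 0)%:R + u k)) (fpow_coef a u) n)) in h1.
    apply: filterS2 h1 h2 => v h1 h2; exact: cvg_unique h1 h2.
  apply/funext => n; rewrite fpow_coef_rec//; congr (_ * cauchy_prod _ _ _).
  by apply/funext => k; rewrite /pseries_diffs add0r.
have F0 : F 0 = 1 by rewrite (has_ps0 fF) u0 addr0.
have Fpos : \forall v \near (0 : R), 0 < F v.
  by apply: (has_ps_near_gt0 fF); rewrite u0 addr0.
pose H v := G v * F v `^ (- a).
have H0 : H 0 = 1.
  by rewrite /H F0 powR1 mulr1 (has_ps0 gG) fpow_coef0.
(* H' = G' F^(-a) - a G F^(-a-1) F' vanishes after substituting G' = a F' G / F. *)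
have : \forall v \near (0 : R), is_derive v (1 : R) H 0.
  near=> v.
  have Fv : 0 < F v by near: v.
  have dFv : is_derive v (1 : R) F (F' v) by near: v.
  have dGv : is_derive v (1 : R) G (G' v) by near: v.
  have odev : F v * G' v = a * (F' v * G v) by near: v.
  have dP := is_derive1_comp (is_derive1_powR (- a) Fv) dFv.
  apply: (is_derive_eq (is_deriveM dGv dP)).
  rewrite /= /GRing.scale /=.
  rewrite powRB ?powRr1 ?(ltW Fv)//; last by rewrite (gt_eqF Fv) implybT.
  have Fn : F v != 0 by rewrite gt_eqF.
  have -> : G' v = a * (F' v * G v) / F v by rewrite -odev mulrAC mulfV ?mul1r.
  by field.
move=> /near_is_derive0_cst HE.
apply: near_has_ps gG; near=> v.
have Fv : 0 < F v by near: v.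
have : H v = 1 by rewrite -H0; near: v.
rewrite /H powRN => /(canRL (mulfVK _)) ->; last by rewrite gt_eqF// powR_gt0.
by rewrite mul1r.
Unshelve. all: by end_near. Qed.

End PowerSeries.

(** * Coefficients of exponential generating functions *)

Section EgfCoef.
Context {R : realType}.
Local Open Scope classical_set_scope.
Implicit Types (c : nat -> R) (F : R -> R).

(** The terms below [k] vanish, so summing from [k] or from 0 gives the same partial sums, also when
    N <= k. *)
Lemma is_egfP k F c : (forall l, (l < k)%N -> c l = 0) ->
  is_egf k F c <-> has_ps (fun n => c n / n`!%:R) F.
Proof.
move=> c0.
have E v : (fun N => \sum_(k <= n < N) c n * (v ^+ n / n`!%:R)) =
           pseries (fun n => c n / n`!%:R) v.
  apply/funext => N; rewrite /pseries /series /=.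
  have [Nk|kN] := leqP N k.
    rewrite big_geq// big_nat_cond big1// => i /andP[/andP[_ iN] _].
    by rewrite c0 ?mul0r// (leq_trans iN).
  rewrite [RHS](@big_cat_nat _ _ _ k) ?(ltnW kN)//= [X in _ = X + _]big_nat_cond.
  rewrite [X in _ = X + _]big1 ?add0r.
    by apply: eq_bigr => i _; rewrite mulrA mulrAC.
  by move=> i /andP[/andP[_ ik] _]; rewrite c0 ?mul0r.
rewrite has_psP; split=> [[_ [e e0 h]]|[e e0 h]].
  by exists e => // v /h; rewrite E.
by split=> //; exists e => // v /h; rewrite E.
Qed.

(** By uniqueness of expansions [c] is the only candidate for [xget], so the default value is not
    taken. *)
Lemma egf_coefE k F c : (forall l, (l < k)%N -> c l = 0) ->
  has_ps (fun n => c n / n`!%:R) F -> egf_coef k F = c.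
Proof.
move=> c0 cF; rewrite /egf_coef.
apply: xget_subset1; first exact/(is_egfP _ c0).
move=> c1 c2 h1 h2.
have /(is_egfP _ h1.1) p1 := h1; have /(is_egfP _ h2.1) p2 := h2.
apply/funext => n; have /(congr1 (fun f => f n)) := has_ps_unique p1 p2.
by apply: mulIf; rewrite invr_eq0 pnatr_eq0 -lt0n fact_gt0.
Qed.

End EgfCoef.

(** * Expansion of the moment generating function *)

Section Mgf.
Context d (T : measurableType d) (R : realType) (P : probability T R).
Context (Y : {RV P >-> R}) (hY : moment_conditions Y).
Local Open Scope classical_set_scope.
Local Open Scope ereal_scope.

Lemma integrable_RV_expn n : P.-integrable setT (EFin \o (fun w => Y w ^+ n)%R).
Proof.
apply/integrableP; split.
  by apply/measurable_EFinP; apply: measurable_funX.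
have := hY.1 n; rewrite unlock; apply: le_lt_trans.
under eq_integral do rewrite /= normrX.
exact: lexx.
Qed.

Lemma moment0 : moment Y 0 = 1%R.
Proof.
by rewrite /moment (_ : (fun w => _) = cst 1%R) ?expectation_cst//;
  apply/funext => w; rewrite expr0.
Qed.

(** At s = rho / 2 the terms s^n E|Y|^n / n! tend to 0, hence are bounded; for |v| < s / 2 the
    series is then dominated by a geometric one of ratio 1/2. *)
Lemma abs_moment_series_lty : exists2 e : R, (0 < e)%R &
  forall v : R, (`|v| < e)%R ->
  \sum_(n <oo) (`|v| ^+ n / n`!%:R)%:E * 'E_P[fun w => (`|Y w| ^+ n)%R] < +oo.
Proof.
have [fin [rho rho0 lim0]] := hY.
have E0 n : 0 <= 'E_P[fun w => (`|Y w| ^+ n)%R].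
  by apply: expectation_ge0 => w; rewrite exprn_ge0.
pose A n := fine 'E_P[fun w => (`|Y w| ^+ n)%R].
have EA n : 'E_P[fun w => (`|Y w| ^+ n)%R] = (A n)%:E.
  by rewrite fineK// ge0_fin_numE.
have A0 n : (0 <= A n)%R by exact: fine_ge0.
pose s : R := (rho / 2)%R.
have s0 : (0 < s)%R by rewrite divr_gt0.
have /lim0 : (`|s| < rho)%R.
  by rewrite gtr0_norm// ltr_pdivrMr// ltr_pMr// ltr1n.
rewrite gtr0_norm// => /cvgP/cvg_seq_bounded[K [_ hK]].
have KA n : (s ^+ n * A n / n`!%:R <= `|K| + 1)%R.
  apply: le_trans (ler_norm _) _.
  by apply: hK => //; rewrite (le_lt_trans (ler_norm _))// ltrDl.
exists (s / 2)%R; first by rewrite divr_gt0.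
move=> v vs.
(* The factor 2 compensates the exponent k + 1 in the denominators. *)
have /cvg_lim h := @cvg_geometric_eseries_half R (2 * (`|K| + 1))%R 0.
apply: (@le_lt_trans _ _
   (\sum_(k <oo) (2 * (`|K| + 1) / (2 ^ (k + 1))%:R)%:E)); last first.
  by rewrite h// ltry.
apply: lee_nneseries => [n _ _|n _]; rewrite EA -EFinM lee_fin.
  by rewrite mulr_ge0// divr_ge0// exprn_ge0.
rewrite addn1 expnS natrM invfM mulrACA mulfV ?pnatr_eq0// mul1r.
have vs2 : (`|v| / s <= 2^-1 :> R)%R by rewrite ler_pdivrMr// mulrC ltW.
have vE : (`|v| = s * (`|v| / s) :> R)%R by rewrite mulrC mulfVK// gt_eqF.
rewrite vE exprMn natrX -exprVn.
have -> : (s ^+ n * (`|v| / s) ^+ n / n`!%:R * A n =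
   (s ^+ n * A n / n`!%:R) * (`|v| / s) ^+ n)%R by ring.
apply: ler_pM => //.
- by rewrite divr_ge0 ?mulr_ge0 ?exprn_ge0// ltW.
- by rewrite exprn_ge0// divr_ge0// ltW.
- apply: (@lerXn2r R n) => //; rewrite nnegrE ?invr_ge0//.
  exact: (divr_ge0 _ (ltW s0)).
Qed.

(** Dominated convergence for the partial sums of e^(vY); integrating each of them termwise yields
    the moments. *)
Lemma has_ps_mgf : has_ps (fun n => moment Y n / n`!%:R)%R (mgf Y).
Proof.
have [e e0 he] := abs_moment_series_lty; apply/has_psP; exists e => // v /he vfin.
pose f_ N (w : T) : \bar R := (series (exp_coeff (v * Y w)) N)%:E.
pose t n (w : T) : \bar R := ((`|v| ^+ n / n`!%:R) * `|Y w| ^+ n)%:E.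
have mY n : measurable_fun setT (fun w => Y w ^+ n)%R.
  exact: measurable_funX.
have mt n : measurable_fun setT (t n).
  apply/measurable_EFinP; apply: measurable_funM => //.
  by apply: measurable_funX; exact: measurableT_comp.
have t0 n w : 0 <= t n w.
  by rewrite lee_fin mulr_ge0 ?divr_ge0 ?exprn_ge0.
(* The dominating function is e^|vY|, kept as a series of nonnegative terms so that it can be
   integrated term by term. *)
pose g w := \sum_(n <oo) t n w.
have mg : measurable_fun setT g by apply: ge0_emeasurable_sum => // n w _ _.
have g0 w : 0 <= g w by apply: nneseries_ge0 => n _ _.
have ig : P.-integrable setT g.
  apply/integrableP; split => //.
  under eq_integral do rewrite gee0_abs//.
  rewrite integral_nneseries//.
  apply: le_lt_trans vfin; apply: lee_nneseries => [n _ _|n _].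
    by apply: integral_ge0 => w _.
  rewrite unlock /t; under eq_integral do rewrite EFinM.
  rewrite ge0_integralZl// ?lee_fin ?divr_ge0 ?exprn_ge0//.
  apply/measurable_EFinP.
  by apply: measurable_funX; exact: measurableT_comp.
have fE N w : f_ N w = \sum_(0 <= n < N) (v ^+ n / n`!%:R)%:E * (Y w ^+ n)%:E.
  rewrite /f_ /series /= -sumEFin; apply: eq_bigr => i _.
  by rewrite -EFinM /exp_coeff /= exprMn mulrAC.
have mf N : measurable_fun setT (f_ N).
  rewrite (_ : f_ N = fun w => \sum_(0 <= n < N)
      (v ^+ n / n`!%:R)%:E * (Y w ^+ n)%:E); last exact/funext.
  apply: emeasurable_sum => n; apply: measurable_funeM.
  exact/measurable_EFinP.
pose f (w : T) : \bar R := (expR (v * Y w))%:E.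
have mfl : measurable_fun setT f.
  apply/measurable_EFinP; apply: measurableT_comp => //.
  exact: measurable_funM.
case: (@dominated_convergence _ _ _ P setT measurableT f_ f g mf mfl).
- apply: aeW => w _; apply: cvg_EFin; first exact: nearW.
  exact: is_cvg_series_exp_coeff.
- exact: ig.
- apply: aeW => w N _.
  apply: (@le_trans _ _ (\sum_(0 <= n < N) t n w)).
    rewrite fE (le_trans (lee_abs_sum _ _ _))//; apply: lee_sum => n _.
    rewrite -EFinM abse_EFin lee_fin !normrM !normrX normfV.
    by rewrite [X in (_ / X)%R]ger0_norm.
  by apply: nneseries_lim_ge.
move=> intf _ fcv.
(* The [fine] in [mgf] loses nothing, as the limit is integrable. *)
have mgfE : (\int[P]_w f w) = (mgf Y v)%:E.
  rewrite /mgf /mmt_gen_fun unlock fineK.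
    by apply: eq_integral => w _; rewrite /f /= mulrC.
  have := integrable_fin_num measurableT intf.
  by congr (_ \is a fin_num); apply: eq_integral => w _; rewrite /f /= mulrC.
rewrite mgfE in fcv.
have := fine_cvg fcv.
rewrite (_ : fine \o _ = pseries (fun n => moment Y n / n`!%:R)%R v); first by apply.
apply/funext => N /=.
under eq_integral do rewrite fE.
rewrite integral_sum//; last first.
  by move=> n; apply: integrableZl => //; exact: integrable_RV_expn.
have fm n : \int[P]_w (Y w ^+ n)%:E = (moment Y n)%:E.
  rewrite /moment unlock fineK//.
  exact: integrable_fin_num (integrable_RV_expn n).
under eq_bigr => n _.
  rewrite integralZl//; last exact: integrable_RV_expn.
  rewrite fm -EFinM.
  over.
rewrite sumEFin /= /pseries /series /=; apply: eq_bigr => n _.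
by rewrite mulrC [LHS]mulrCA mulrC.
Qed.

End Mgf.

(** * The q-number relation and the comparison of coefficients *)

Lemma qnumB (R : realType) (q x : R) : 0 < q < 1 ->
  qnum q (1 - x) + qnum q^-1 x = 1.
Proof.
move=> /andP[q0 q1]; rewrite /qnum.
have qN0 : q != 0 by rewrite gt_eqF.
have qx : q `^ x != 0 by rewrite gt_eqF// powR_gt0.
(* All powers are reduced to q^x, leaving a rational identity in q and q^x. *)
rewrite powRB ?qN0 ?implybT// powRr1 ?ltW// -(powR_inv1 (ltW q0)).
rewrite -powRrM mulN1r powRN (powR_inv1 (ltW q0)).
by field; rewrite qx qN0 mulN1r !subr_eq0 (lt_eqF q1) (gt_eqF q1).
Qed.

Theorem theorem2p3 (d : measure_display) (T : measurableType d) (R : realType)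
    (P : probability T R) (Y : {RV P >-> R}) (q x : R) (n r : nat)
    (hY : moment_conditions Y) (hq : 0 < q < 1) (hx : 0 <= x <= 1)
    (hr : (r <= n)%N) (hE : moment Y (n - r) <> 0) :
  qnum q x ^+ r =
    1 / moment Y (n - r) *
    \sum_(l < n.+1) \sum_(m < (n - l).+1)
      pstirling2 Y (n - l) m * ('C(n, l)%:R / 'C(n, r)%:R)
      * falling (qnum q^-1 x) m * qBernstein Y r l x q.
Proof.
have fact_neq0 k : k`!%:R != 0 :> R by rewrite pnatr_eq0 -lt0n fact_gt0.
pose f k := moment Y k / k`!%:R.
(* Coefficients of F - 1: the constant term drops out because the zeroth moment is 1. *)
pose u k := if k == 0%N then 0 else f k.
have fF : has_ps f (mgf Y) := has_ps_mgf hY.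
have fE : f = fun k => (k == 0%N)%:R + u k.
  apply/funext => -[|k]; rewrite /u /= ?add0r// addr0 /f.
  by rewrite moment0 divr1.
have uF : has_ps u (fun v => mgf Y v - 1) by apply: has_psB1; rewrite -fE.
have powF a : has_ps (fpow_coef a u) (fun v => mgf Y v `^ a).
  by apply: has_ps_powR => //; rewrite -fE.
have S k m : pstirling2 Y k m = cpow u m k / m`!%:R * k`!%:R.
  rewrite /pstirling2.
  rewrite (@egf_coefE _ m _ (fun k => cpow u m k / m`!%:R * k`!%:R))//.
    by move=> l lm; rewrite cpow_small// !mul0r.
  under eq_fun do rewrite mulfK// mulrC.
  under [X in has_ps _ X]eq_fun do rewrite mulrC.
  exact/has_psZ/has_ps_cpow.
(* The prefactor (v [x]_q)^r / r! as a monomial, so that [b] vanishes below [r]. *)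
pose p : {poly R} := (qnum q x ^+ r / r`!%:R) *: 'X^r.
pose b := cauchy_prod (fun k => p`_k) (fpow_coef (qnum q (1 - x)) u).
have bF : has_ps b (fun v => p.[v] * mgf Y v `^ qnum q (1 - x)).
  exact: has_psM (has_ps_poly p) (powF _).
have B l : qBernstein Y r l x q = b l * l`!%:R.
  rewrite /qBernstein (@egf_coefE _ r _ (fun l => b l * l`!%:R))//.
    move=> k kr; rewrite /b /cauchy_prod big1 ?mul0r// => i _.
    rewrite coefZ coefXn ltn_eqF ?mulr0 ?mul0r//.
    by rewrite (leq_ltn_trans _ kr)// -ltnS.
  under eq_fun do rewrite mulfK//.
  apply: near_has_ps bF; near=> v.
  by rewrite hornerZ hornerXn (exprMn _ v); congr (_ * _); rewrite mulrC mulrA.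
have mgfpos : \forall v \near 0, 0 < mgf Y v.
  by apply: (has_ps_near_gt0 fF); rewrite /f moment0 divr1.
(* Both sides expand p F^a F^z = p F, valid near 0 where F is positive. *)
have key : cauchy_prod b (fpow_coef (qnum q^-1 x) u) =
           cauchy_prod (fun k => p`_k) f.
  apply: (has_ps_unique (has_psM bF (powF (qnum q^-1 x)))).
  apply: near_has_ps (has_psM (has_ps_poly p) fF); near=> v.
  have Fv : 0 < mgf Y v by near: v.
  rewrite -mulrA -powRD ?(gt_eqF Fv) ?implybT// qnumB// powRr1//.
  exact: ltW.
have {key} := congr1 (fun c => c n) key.
have -> : cauchy_prod (fun k => p`_k) f n =
    qnum q x ^+ r / r`!%:R * (moment Y (n - r) / (n - r)`!%:R).
  rewrite /cauchy_prod (bigD1 (@Ordinal n.+1 r hr))//= big1 ?addr0.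
    by rewrite coefZ coefXn eqxx mulr1.
  by move=> i /negbTE ir; rewrite coefZ coefXn [_ == _]ir mulr0 mul0r.
move=> key.
have binE k : (k <= n)%N -> 'C(n, k)%:R = n`!%:R / (k`!%:R * (n - k)`!%:R) :> R.
  move=> kn; rewrite -(bin_fact kn) !natrM mulfK// mulf_neq0.
(* This solves [key] for [x]_q^r, dividing by the moment, nonzero by [hE]. *)
transitivity ((moment Y (n - r))^-1 * (r`!%:R * (n - r)`!%:R) *
  cauchy_prod b (fpow_coef (qnum q^-1 x) u) n).
  rewrite key; field; rewrite !fact_neq0 /=; exact/eqP.
rewrite div1r -mulrA; congr (_ * _); rewrite /cauchy_prod mulr_sumr.
apply: eq_bigr => l _.
have ln : (l <= n)%N by rewrite -ltnS.
rewrite /fpow_coef !mulr_sumr; apply: eq_bigr => m _.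
rewrite S B !binE//; field.
by rewrite !fact_neq0.
Unshelve. all: by end_near. Qed.
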